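(* Let $d\ge 1$ be an integer, let $k$ be a local field, and let $\|\cdot\|$ be a submultiplicative norm on $M_d(k)$. There exist a positive integer $N=N(d)\le \prod_{i=1}^{d}\binom{d}{i}$ depending only on $d$, a positive constant $r=r(d,N)\le (Nd+1)^{Nd^2+2}$ depending only on $d$ and $N$, and a constant $C=C(d,\|\cdot\|)>1$ such that for all $n\ge N$ and all $A_1,\dots,A_n\in M_d(k)$: $$\|A_n\cdots A_1\|\le C\left(\prod_{1\le i\le n}\|A_i\|\right)\max_{1\le\alpha\le\beta\le n}\left(\frac{\rho(A_\beta A_{\beta-1}\cdots A_\alpha)}{\prod_{\alpha\le i\le\beta}\|A_i\|}\right)^{1/r},$$ where the right-hand side is treated as zero if one of the $A_i$ is the zero matrix.
   Context: $M_d(k)$ is the algebra of $d\times d$ matrices over $k$. A local field is a field $k$ together with an absolute value $|\cdot|$ whose induced metric gives a non-discrete locally compact topology on $k$ (e.g. $\mathbb{R}$, $\mathbb{C}$ with the standard absolute values, $\mathbb{Q}_p$). The absolute value extends uniquely to the algebraic closure $\overline{k}$, and the spectral radius $\rho(A)$ of $A\in M_d(k)$ is the maximum of $|\lambda|$ over the eigenvalues $\lambda\in\overline{k}$ of $A$. A norm on $M_d(k)$ is a norm of $k$-vector spaces with respect to $|\cdot|$; it is submultiplicative if $\|AB\|\le\|A\|\,\|B\|$ for all $A,B$. *)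

(* Defs.v *)
From HB Require Import structures.
From mathcomp Require Import all_boot all_order all_algebra.
From mathcomp Require Import all_classical all_reals all_analysis.

Set Implicit Arguments.
Unset Strict Implicit.
Unset Printing Implicit Defensive.

Import Order.TTheory GRing.Theory Num.Theory.
Import numFieldNormedType.Exports.

Local Open Scope classical_set_scope.
Local Open Scope ring_scope.

Record absolute_value (R : realType) (k : fieldType) := AbsoluteValue {
  absv :> k -> R;
  absv_ge0 : forall x, 0 <= absv x;
  absv_eq0 : forall x, absv x = 0 <-> x = 0;
  absvM : forall x y, absv (x * y) = absv x * absv y;
  absvD : forall x y, absv (x + y) <= absv x + absv y }.

(* An alias of [k] that carries the metric [absv (x - y)] and its topology. *)
Definition absv_space (R : realType) (k : fieldType)
  (v : absolute_value R k) : Type := k.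

Section AbsvSpace.
Context (R : realType) (k : fieldType) (v : absolute_value R k).

Lemma absv0 : v 0 = 0.
Proof. exact/absv_eq0. Qed.

Lemma absv1 : v 1 = 1.
Proof.
have v1 : v 1 != 0 by apply/eqP => /absv_eq0/eqP; rewrite oner_eq0.
by apply: (mulfI v1); rewrite -absvM !mulr1.
Qed.

Lemma absvN x : v (- x) = v x.
Proof.
have vN1 : v (-1) = 1.
  apply/eqP; rewrite -(@pexpr_eq1 _ _ 2) ?absv_ge0//.
  by rewrite expr2 -absvM mulrNN mulr1 absv1.
by rewrite -mulN1r absvM vN1 mul1r.
Qed.

(* The library's normed types require [`|x *+ n| = `|x| *+ n], which fails for
   non-archimedean absolute values; hence the metric is built from its balls. *)
Definition absv_ball (x : absv_space v) (e : R) : set (absv_space v) :=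
  [set y | v ((x : k) - y) < e].

Definition absv_ent : set_system (absv_space v * absv_space v) :=
  entourage_ absv_ball.

Lemma absv_ball_center x (e : R) : 0 < e -> absv_ball x e x.
Proof. by rewrite /absv_ball /= subrr absv0. Qed.

Lemma absv_ball_sym x y (e : R) : absv_ball x e y -> absv_ball y e x.
Proof. by rewrite /absv_ball /= -absvN opprB. Qed.

Lemma absv_ball_triangle x y z (e1 e2 : R) :
  absv_ball x e1 y -> absv_ball y e2 z -> absv_ball x (e1 + e2) z.
Proof.
rewrite /absv_ball /= => xy yz.
rewrite -[_ - _](subrKA (y : k)).
exact: le_lt_trans (absvD _ _ _) (ltrD xy yz).
Qed.

HB.instance Definition _ := Choice.copy (absv_space v) k.
HB.instance Definition _ := hasNbhs.Build (absv_space v) (nbhs_ absv_ent).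
HB.instance Definition _ := @Nbhs_isPseudoMetric.Build R (absv_space v)
  absv_ent erefl absv_ball absv_ball_center absv_ball_sym absv_ball_triangle
  erefl.

Record is_local_field : Prop := IsLocalField {
  local_field_nondiscrete : ~ (forall U : set (absv_space v), open U);
  local_field_locally_compact : locally_compact [set: absv_space v] }.

Record is_norm (V : lmodType k) (N : V -> R) : Prop := IsNorm {
  is_norm_ge0 : forall x, 0 <= N x;
  is_norm_eq0 : forall x, N x = 0 <-> x = 0;
  is_normZ : forall a x, N (a *: x) = v a * N x;
  is_normD : forall x y, N (x + y) <= N x + N y }.

End AbsvSpace.

Definition submultiplicative (R : realType) (k : fieldType) (d : nat)
    (N : 'M[k]_d -> R) : Prop :=
  forall A B, N (A *m B) <= N A * N B.

(* [kbar], which is algebraically closed by its type, is an algebraic closure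
   of [k] along [iota]. *)
Definition is_algebraic_closure (k : fieldType) (kbar : closedFieldType)
    (iota : {rmorphism k -> kbar}) : Prop :=
  forall x : kbar, algebraicOver iota x.

Section SpectralRadius.
Context (R : realType) (k : fieldType) (kbar : closedFieldType).
Context (iota : {rmorphism k -> kbar}) (w : absolute_value R kbar).

Definition spectral_radius (d : nat) (A : 'M[k]_d) : R :=
  sup [set w l | l in [set l : kbar | eigenvalue (map_mx iota A) l]].

(* The supremum is a maximum. *)
Lemma spectral_radius_max (d : nat) (A : 'M[k]_d) : (0 < d)%N ->
  (exists2 l, eigenvalue (map_mx iota A) l & w l = spectral_radius A) /\
  (forall l, eigenvalue (map_mx iota A) l -> w l <= spectral_radius A).
Proof.
move=> d0; pose p := char_poly (map_mx iota A).
have [s ps] := closed_field_poly_normal p.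
rewrite (monicP (char_poly_monic _)) scale1r in ps.
have eigE l : eigenvalue (map_mx iota A) l = (l \in s).
  by rewrite eigenvalue_root_char -/p ps root_prod_XsubC.
have sz : (0 < size s)%N.
  have := congr1 (@size _ \o @polyseq _) ps.
  by rewrite /= size_char_poly size_prod_XsubC => -[<-].
have [m ms mmax] : exists2 m, m \in s & forall l, l \in s -> w l <= w m.
  elim: s sz {ps eigE} => // a [|b s] IH _.
    by exists a => [|l]; rewrite inE // => /eqP ->.
  have [//|m ms mmax] := IH; have [ma|am] := leP (w m) (w a).
    exists a => [|l]; rewrite inE ?eqxx// => /predU1P[->//|/mmax lm].
    exact: le_trans lm ma.
  exists m => [|l]; rewrite inE ?ms ?orbT// => /predU1P[->|/mmax//].
  exact: ltW.
have wm : w m = spectral_radius A.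
  apply/eqP; rewrite eq_le; apply/andP; split.
    apply: ub_le_sup; last by exists m => //=; rewrite eigE.
    by exists (w m) => _ /= [l + <-]; rewrite eigE => /mmax.
  apply: ge_sup; first by exists (w m), m => //=; rewrite eigE.
  by move=> _ /= [l + <-]; rewrite eigE => /mmax.
split; first by exists m; rewrite ?eigE.
by move=> l; rewrite eigE -wm => /mmax.
Qed.

End SpectralRadius.

(* The product A_b *m ... *m A_(a+1) *m A_a. *)
Definition mxprod_rev (k : fieldType) (d : nat) (A : nat -> 'M[k]_d)
    (a b : nat) : 'M[k]_d :=
  \big[mulmx/1%:M]_(i <- rev (index_iota a b.+1)) A i.

(* Main.v *)
Require Import Defs.
From mathcomp Require Import all_boot all_order all_algebra.
From mathcomp Require Import all_classical all_reals all_analysis.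
From mathcomp Require Import perm zify ring lra.

Import Order.TTheory GRing.Theory Num.Theory.
Import numFieldNormedType.Exports.
Local Open Scope ring_scope.

Set Implicit Arguments.
Unset Strict Implicit.
Unset Printing Implicit Defensive.

(** The proof makes quantitative the following exact statement: if all products
    [A_j ... A_i], [1 <= i <= j <= N], are nilpotent, where
    [N = \prod_(1 <= p <= d) 'C(d, p)], then [A_N ... A_1 = 0].

    The exact statement holds because the rank drops. Suppose that the blocks
    [B_0, ..., B_M], with [M + 1 = 'C(d, p)], are products of consecutive [A_i]
    and have rank at most [p], so that [B_i = X_i Y_i] with inner dimension [p].
    Put [G i j = \det (Y_i X_j)]. Nilpotency of [B_j ... B_i] gives
    [G (i+1) i * ... * G j (j-1) * G i j = 0] for [i <= j]. If the product of
    the subdiagonal entries [G (l+1) l] is not zero, then [G] vanishes on and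
    above the diagonal (and if it is zero, so are the minors considered below,
    which are multiples of it). Now border [G] by coordinate functions: put in
    front a column for a [d x p] submatrix of the identity, and at the bottom a
    row for a [p x d] submatrix. The result is lower triangular; it has size
    ['C(d, p) + 1], and it is singular since the pairing [\det (Y X)] factors
    through a space of dimension ['C(d, p)] ([det_pairing_eq0]). The product of
    its diagonal entries is a minor of size [p] of [B_M ... B_0]. So all these
    minors vanish and [B_M ... B_0] has rank at most [p - 1]. Descending from
    [p = d] to [p = 0] produces zero after [N] factors.

    For the inequality, let the [A_i] be bounded and let all spectral radii be
    [O(x ^ r)], with [0 <= x <= 1]. Replace zero by [O(x ^ s)] with constants
    uniform in the data ([order_ge]), and rank at most [p] by a factorization
    [X Y] with inner dimension [p] and bounded factors, up to [O(x ^ s)]. Three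
    things then cost a factor in the exponent [s] when [p] decreases by one.
    Nilpotency is replaced by [B ^ d = O(x ^ r)], a consequence of
    Cayley-Hamilton ([mx_order_ge_eigen]), and going from there to a
    determinant takes a [(d+1)]-st root. The bordered determinant bounds the
    square of a minor, since the entries of [G] are only small after
    multiplication by the product of the subdiagonal entries. Finally, minors
    [O(x ^ (p s))] give an approximation of rank [p - 1] up to [O(x ^ s)]
    ([low_rank_approx]). Altogether [r = \prod_(1 <= p <= d) (d+1) * 2 * p], and
    [A_N ... A_1 = O(x)] ([chain_le_uniform]).

    This estimate is proved over the algebraic closure. It becomes homogeneous
    after dividing the matrices by scalars of [k] comparable to their norms,
    which exist since the absolute value of [k] is not trivial; [x] is the
    maximum on the right-hand side. Factors beyond the first [N] are handled
    by submultiplicativity. *)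

(** * Minors *)

Section Minors.
Context (F : fieldType).

Definition ord_cons (p m : nat) (i0 : 'I_m) (f : 'I_p -> 'I_m)
    (k : 'I_(1 + p)) : 'I_m :=
  if fintype.split k is inr l then f l else i0.

(** One step of Gaussian elimination with pivot [P i0 j0], seen on minors. *)
Lemma det_pivot m n p (P : 'M[F]_(m, n)) i0 j0
    (f : 'I_p -> 'I_m) (g : 'I_p -> 'I_n) :
  P i0 j0 != 0 ->
  \det (mxsub (ord_cons i0 f) (ord_cons j0 g) P) =
  P i0 j0 * \det (mxsub f g (P - (P i0 j0)^-1 *: (col j0 P *m row i0 P))).
Proof.
move=> nz; set S := P - _.
set c := \col_i P (f i) j0; set r := \row_j P i0 (g j).
have -> : mxsub (ord_cons i0 f) (ord_cons j0 g) P =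
    block_mx (P i0 j0)%:M r c (mxsub f g P).
  apply/matrixP => i j; rewrite !mxE /ord_cons.
  by case: splitP => k _; rewrite !mxE; case: splitP => l _;
     rewrite !mxE // !ord1.
have e : block_mx 1%:M 0 (- (P i0 j0)^-1 *: c) 1%:M *m
    block_mx (P i0 j0)%:M r c (mxsub f g P) =
    block_mx (P i0 j0)%:M r 0 (mxsub f g S).
  rewrite mulmx_block !mul1mx !mul0mx !addr0 mul_mx_scalar scalerA mulrN.
  rewrite mulfV // scaleN1r addNr; congr block_mx.
  apply/matrixP => i j; rewrite !mxE big_ord1 /S !mxE big_ord1 !mxE addrC.
  by rewrite !mulNr mulrA.
have := congr1 determinant e.
by rewrite det_mulmx det_lblock !det1 !mul1r det_ublock det_scalar1.
Qed.

Lemma det_mulmx_rowsub p d (Y : 'M[F]_(p, d)) (X : 'M[F]_(d, p)) :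
  \det (Y *m X) =
  \sum_(f : {ffun 'I_p -> 'I_d}) (\prod_i Y i (f i)) * \det (rowsub f X).
Proof.
transitivity (\sum_(s : 'S_p) \sum_(f : {ffun 'I_p -> 'I_d})
    (-1) ^+ s * \prod_i (Y i (f i) * X (f i) (s i))).
  apply: eq_bigr => s _; rewrite -big_distrr /=; congr (_ * _).
  rewrite -(bigA_distr_bigA (fun i j => Y i j * X j (s i))) /=.
  by apply: eq_bigr => x _; rewrite mxE.
rewrite exchange_big; apply: eq_bigr => f _ /=.
rewrite big_distrr /=; apply: eq_bigr => s _.
rewrite big_split /= mulrCA; congr (_ * (_ * _)).
by apply: eq_bigr => i _; rewrite mxE.
Qed.

Lemma det_rowsub_noninj p d (f : 'I_p -> 'I_d) (X : 'M[F]_(d, p)) :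
  ~ injective f -> \det (rowsub f X) = 0.
Proof.
move=> /injectiveP/injectivePn[i [j ij fij]].
by apply: (determinant_alternate ij) => k; rewrite !mxE fij.
Qed.

Lemma det_rowsub_image p d (f g : {ffun 'I_p -> 'I_d}) : injective f ->
  f @: 'I_p = g @: 'I_p ->
  exists s : F, forall X : 'M[F]_(d, p),
    \det (rowsub f X) = s * \det (rowsub g X).
Proof.
move=> finj fg.
have ex i : exists j, g j = f i.
  have : f i \in g @: 'I_p by rewrite -fg imset_f.
  by case/imsetP => j _ ->; exists j.
have [s sE] := fin_all_exists ex.
have sinj : injective s by move=> i j ij; apply: finj; rewrite -!sE ij.
exists ((-1) ^+ perm sinj) => X; rewrite -det_perm -det_mulmx -row_permE.
by congr (\det _); apply/matrixP => i j; rewrite !mxE permE sE.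
Qed.

(** A weak form of the Cauchy-Binet formula: grouping the terms of
    [det_mulmx_rowsub] by the image of [f], and comparing each minor with one
    representative per image, shows that [\det (Y *m X)] is a pairing of two
    vectors indexed by the ['C(d, p)] subsets of size [p]. *)
Lemma det_mulmx_minors p d :
  exists (c : 'M[F]_(p, d) -> {set 'I_d} -> F)
    (m : {set 'I_d} -> 'M[F]_(d, p) -> F),
  forall Y X, \det (Y *m X) = \sum_(K : {set 'I_d} | #|K| == p) c Y K * m K X.
Proof.
pose good K := [pred f : {ffun 'I_p -> 'I_d} | injectiveb f & f @: 'I_p == K].
pose rep K := [pick f in good K].
pose m K (X : 'M[F]_(d, p)) := if rep K is Some f then \det (rowsub f X) else 0.
have sgn (f : {ffun 'I_p -> 'I_d}) : exists s : F, injective f ->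
    forall X, \det (rowsub f X) = s * m (f @: 'I_p) X.
  have [/injectiveP finj|/injectiveP fN] := boolP (injectiveb f); last first.
    by exists 0.
  rewrite /m /rep; case: pickP => [g|/(_ f)]; last first.
    by rewrite !inE eqxx andbT => /injectiveP.
  rewrite inE => /andP[_ /eqP gf].
  by have [s Hs] := det_rowsub_image finj (esym gf); exists s.
have [s Hs] := fin_all_exists sgn.
exists (fun Y K => \sum_(f in good K) (\prod_i Y i (f i)) * s f), m => Y X.
rewrite det_mulmx_rowsub (bigID (fun f : {ffun _} => injectiveb f)) /=.
rewrite [X in _ + X]big1 ?addr0; last first.
  by move=> f /injectiveP fN; rewrite det_rowsub_noninj ?mulr0.
rewrite (partition_big (fun f : {ffun 'I_p -> 'I_d} => f @: 'I_p)
  (fun K : {set 'I_d} => #|K| == p)) /=; last first.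
  by move=> f /injectiveP fI; rewrite card_imset // card_ord.
apply: eq_bigr => K _; rewrite mulr_suml; apply: eq_big => f.
  by rewrite !inE.
by case/andP => /injectiveP fI /eqP <-; rewrite Hs // mulrA.
Qed.

(** The matrix [(\det (Y i *m X j))] factors through a space of dimension
    ['C(d, p)], hence is singular as soon as it is larger than that. This takes
    the place of the statement that the [p]-th exterior power of a
    [d]-dimensional space has dimension ['C(d, p)]. *)
Lemma det_pairing_eq0 p d n
    (Y : 'I_n -> 'M[F]_(p, d)) (X : 'I_n -> 'M[F]_(d, p)) :
  ('C(d, p) < n)%N -> \det (\matrix_(i, j) \det (Y i *m X j)) = 0.
Proof.
move=> ltn; have [c [m cm]] := det_mulmx_minors p d.
pose S := [set K : {set 'I_d} | #|K| == p].
have -> : \matrix_(i, j) \det (Y i *m X j) =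
    (\matrix_(i < n, k < #|S|) c (Y i) (enum_val k)) *m
    (\matrix_(k < #|S|, j < n) m (enum_val k) (X j)).
  apply/matrixP => i j; rewrite !mxE cm.
  under [RHS]eq_bigr do rewrite !mxE.
  rewrite (eq_bigl (mem S)) => [|K]; last by rewrite !inE.
  exact: big_enum_val (fun K => c (Y i) K * m K (X j)).
apply/eqP; set A := (X in \det X); apply: contraTT ltn => detA.
have : A \in unitmx by rewrite unitmxE unitfE.
rewrite -row_free_unit /row_free => /eqP rk.
rewrite -leqNgt -[X in (X <= _)%N]rk.
apply: leq_trans (mxrankM_maxl _ _) _.
by apply: leq_trans (rank_leq_col _) _; rewrite card_draws card_ord.
Qed.

End Minors.

(** * Approximation by matrices of low rank *)

Section AbsTheory.
Context (R : realType) (K : fieldType) (w : absolute_value R K).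

Lemma absvX x n : w (x ^+ n) = w x ^+ n.
Proof. by elim: n => [|n IH]; rewrite ?absv1 // !exprS absvM IH. Qed.

Lemma absvV x : w x^-1 = (w x)^-1.
Proof.
have [->|x0] := eqVneq x 0; first by rewrite invr0 absv0 invr0.
have wx : w x != 0 by apply: contra_neq x0 => /absv_eq0.
by apply: (mulfI wx); rewrite -absvM !mulfV // absv1.
Qed.

(** If all minors of size [p + 1] are at most [x ^+ p.+1], Gaussian elimination
    with full pivoting, stopped once the remaining entries are at most [x],
    performs at most [p] steps: each pivot is larger than [x], so that removing
    it divides the bound on the minors by more than [x]. Full pivoting keeps the
    entries of the first factor at most [1], and each step at most doubles the
    size of the entries left. *)
Lemma low_rank_approx p m n (P : 'M[K]_(m, n)) (x c : R) :
  0 <= x -> 0 <= c -> (forall i j, w (P i j) <= c) ->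
  (forall (f : 'I_p.+1 -> 'I_m) (g : 'I_p.+1 -> 'I_n),
     w (\det (mxsub f g P)) <= x ^+ p.+1) ->
  exists (X : 'M[K]_(m, p)) (Y : 'M[K]_(p, n)),
  [/\ forall i j, w (X i j) <= 1,
      forall i j, w (Y i j) <= 2 ^+ p * c &
      forall i j, w ((P - X *m Y) i j) <= x].
Proof.
move=> x0; elim: p m n P c => [|p IH] m n P c c0 Pc minors.
  exists 0, 0; split=> [i []|[]|i j] //.
  rewrite mulmx0 subr0.
  by have := minors (fun=> i) (fun=> j); rewrite det_mx11 mxE expr1.
case: (pselect (forall i j, w (P i j) <= x))
  => [Px|/existsNP[i /existsNP[j /negP]]].
  exists 0, 0; split=> i j; rewrite ?mulmx0 ?subr0 //.
    by rewrite mxE absv0.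
  by rewrite mxE absv0 mulr_ge0 // exprn_ge0.
rewrite -ltNge => xPij.
case: (@arg_maxP _ _ _ (i, j) xpredT (fun k => w (P k.1 k.2)))
  => // -[i0 j0] _ /= max0.
have xd : x < w (P i0 j0) by apply: lt_le_trans xPij (max0 (i, j) isT).
have d0 : 0 < w (P i0 j0) by apply: le_lt_trans xd.
have nz : P i0 j0 != 0 by apply: contraTneq d0 => ->; rewrite absv0 ltxx.
set S := P - (P i0 j0)^-1 *: (col j0 P *m row i0 P).
(* Here the maximality of the pivot is used. *)
have colb k : w ((P i0 j0)^-1 * P k j0) <= 1.
  by rewrite absvM absvV ler_pdivrMl // mulr1 (max0 (k, j0)).
have [|||X [Y [Xb Yb XYb]]] := IH _ _ S (2 * c).
- by rewrite mulr_ge0.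
- move=> k l; rewrite !mxE big_ord1 !mxE mulrA mulr_natl mulr2n.
  apply: le_trans (absvD _ _ _) _; rewrite absvN absvM.
  by apply: lerD => //; rewrite -[leRHS]mul1r ler_pM ?absv_ge0.
- move=> f g; have := minors (ord_cons i0 f) (ord_cons j0 g).
  rewrite det_pivot // absvM -/S exprSr => h.
  have h2 : w (P i0 j0) * w (\det (mxsub f g S)) <= w (P i0 j0) * x ^+ p.+1.
    apply: le_trans h _; rewrite mulrC ler_wpM2r ?exprn_ge0 //; exact: ltW.
  by rewrite ler_pM2l in h2.
exists (row_mx ((P i0 j0)^-1 *: col j0 P) X : 'M[K]_(m, 1 + p)).
exists (col_mx (row i0 P) Y : 'M[K]_(1 + p, n)); split=> k l.
- by rewrite mxE; case: splitP => l' _; rewrite ?mxE.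
- rewrite mxE; case: splitP => l' _; rewrite ?mxE.
    rewrite (le_trans (Pc _ _)) // ler_peMl // exprn_ege1 //.
    by rewrite ler1n.
  by rewrite exprSr -mulrA.
- rewrite (mul_row_col ((P i0 j0)^-1 *: col j0 P) X (row i0 P) Y) -scalemxAl.
  by rewrite opprD addrA; apply: XYb.
Qed.

End AbsTheory.

(** * The filtration by order of magnitude *)

Section Orders.
Context (R : realType) (K : fieldType) (w : absolute_value R K).
Context (T : Type) (E : T -> R) (E01 : forall t, 0 <= E t <= 1).

(** The data (matrices and the small real number [E t]) are indexed by [t : T],
    and scalars and matrices are functions of [t]. Functions with
    [order_ge s f], that is, [f = O(E ^ s)] uniformly in [t], form a decreasing
    filtration of the ring of bounded functions; this is what makes it possible
    to follow the nilpotent case without tracking constants. *)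
Definition order_ge (s : nat) (f : T -> K) :=
  exists2 C, 0 <= C & forall t, w (f t) <= C * E t ^+ s.

Definition mx_order_ge m n (s : nat) (A : T -> 'M[K]_(m, n)) :=
  forall i j, order_ge s (fun t => A t i j).

Let E0 t s : 0 <= E t ^+ s.
Proof. by rewrite exprn_ge0 //; case/andP: (E01 t). Qed.

Lemma order_ge_ext s f g : f =1 g -> order_ge s f -> order_ge s g.
Proof. by move=> fg [C C0 fC]; exists C => // t; rewrite -fg. Qed.

Lemma order_ge_cst c : order_ge 0 (fun=> c).
Proof. by exists (w c); rewrite ?absv_ge0 // => t; rewrite mulr1. Qed.

Lemma order_ge0 s : order_ge s (fun=> 0).
Proof. by exists 0 => // t; rewrite absv0 mul0r. Qed.

Lemma order_geD s f g :
  order_ge s f -> order_ge s g -> order_ge s (fun t => f t + g t).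
Proof.
move=> [C C0 fC] [D D0 gD]; exists (C + D); rewrite ?addr_ge0 // => t.
by rewrite mulrDl (le_trans (absvD _ _ _)) // lerD.
Qed.

Lemma order_geN s f : order_ge s f -> order_ge s (fun t => - f t).
Proof. by move=> [C C0 fC]; exists C => // t; rewrite absvN. Qed.

Lemma order_geM s u f g :
  order_ge s f -> order_ge u g -> order_ge (s + u) (fun t => f t * g t).
Proof.
move=> [C C0 fC] [D D0 gD]; exists (C * D); rewrite ?mulr_ge0 // => t.
by rewrite absvM exprD mulrACA ler_pM ?absv_ge0.
Qed.

Lemma order_geW s u f : (u <= s)%N -> order_ge s f -> order_ge u f.
Proof.
move=> us [C C0 fC]; exists C => // t; apply: le_trans (fC t) _.
by rewrite ler_wpM2l // ler_wiXn2l //; case/andP: (E01 t).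
Qed.

Lemma order_ge_bounded s f : order_ge s f -> order_ge 0 f.
Proof. exact: order_geW. Qed.

Lemma order_geMl s f g :
  order_ge 0 f -> order_ge s g -> order_ge s (fun t => f t * g t).
Proof. exact: order_geM. Qed.

Lemma order_geMr s f g :
  order_ge s f -> order_ge 0 g -> order_ge s (fun t => f t * g t).
Proof. by move=> fs g0; have := order_geM fs g0; rewrite addn0. Qed.

Lemma order_ge_sum s (I : Type) (r : seq I) (P : pred I) (f : I -> T -> K) :
  (forall i, P i -> order_ge s (f i)) ->
  order_ge s (fun t => \sum_(i <- r | P i) f i t).
Proof.
move=> fs; elim: r => [|i r IH].
  by apply: order_ge_ext (order_ge0 s) => t; rewrite big_nil.
apply: (@order_ge_ext _ (fun t => (if P i then f i t else 0) +
  \sum_(j <- r | P j) f j t)) => [t|].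
  by rewrite big_cons; case: ifP => //; rewrite add0r.
apply: order_geD IH; case: (P i) (fs i) => [h|_]; first exact: h.
exact: order_ge0.
Qed.

Lemma order_ge_prod (I : Type) (r : seq I) (P : pred I) (f : I -> T -> K) :
  (forall i, P i -> order_ge 0 (f i)) ->
  order_ge 0 (fun t => \prod_(i <- r | P i) f i t).
Proof.
move=> fs; elim: r => [|i r IH].
  by apply: order_ge_ext (order_ge_cst 1) => t; rewrite big_nil.
apply: (@order_ge_ext _ (fun t => (if P i then f i t else 1) *
  \prod_(j <- r | P j) f j t)) => [t|].
  by rewrite big_cons; case: ifP => //; rewrite mul1r.
apply: order_geMl IH; case: (P i) (fs i) => [h|_]; first exact: h.
exact: order_ge_cst.
Qed.

(** The constant [C] becomes [C + 1], which dominates the root of [C] because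
    [C <= (C + 1) ^+ k.+1]. *)
Lemma order_ge_root k s f :
  order_ge (k.+1 * s) (fun t => f t ^+ k.+1) -> order_ge s f.
Proof.
move=> [C C0 fC]; exists (C + 1); rewrite ?addr_ge0 // => t.
rewrite -(@ler_pXn2r _ k.+1) // ?nnegrE ?absv_ge0 ?mulr_ge0 ?addr_ge0 //.
rewrite -absvX (le_trans (fC t)) // exprMn -exprM mulnC ler_wpM2r //.
rewrite (@le_trans _ _ (C + 1)) ?lerDl //.
by rewrite exprS ler_peMr ?addr_ge0 // exprn_ege1 // lerDr.
Qed.

Lemma order_ge_uniform (I : finType) s (f : I -> T -> K) :
  (forall i, order_ge s (f i)) ->
  exists2 C, 1 <= C & forall i t, w (f i t) <= C * E t ^+ s.
Proof.
move=> fs; have /choice[C HC] : forall i, exists C, 0 <= C /\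
    forall t, w (f i t) <= C * E t ^+ s by move=> i; have [c] := fs i; exists c.
exists (1 + \sum_i C i).
  by rewrite lerDl sumr_ge0 // => i _; case: (HC i).
move=> i t; have [_ h] := HC i; apply: le_trans (h t) _.
rewrite ler_wpM2r // (bigD1 i) //= addrCA lerDl addr_ge0 // sumr_ge0 // => j _.
by case: (HC j).
Qed.

Lemma order_ge_det n s (A : T -> 'M[K]_n) :
  (forall sg : {perm 'I_n}, order_ge s (fun t => \prod_i A t i (sg i))) ->
  order_ge s (fun t => \det (A t)).
Proof.
move=> As; apply: order_ge_sum => sg _; apply: order_geMl (As sg).
exact: order_ge_cst.
Qed.

Lemma order_ge_det0 n (A : T -> 'M[K]_n) :
  mx_order_ge 0 A -> order_ge 0 (fun t => \det (A t)).
Proof.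
by move=> A0; apply: order_ge_det => sg; apply: order_ge_prod => i _; apply: A0.
Qed.

(** Every term of the expansion of a determinant of positive size contains one
    entry of order [s]; the others are merely bounded. *)
Lemma order_ge_detS n s (A : T -> 'M[K]_n.+1) :
  mx_order_ge s A -> order_ge s (fun t => \det (A t)).
Proof.
move=> As; apply: order_ge_det => sg.
apply: (@order_ge_ext _ (fun t => A t ord0 (sg ord0) *
  \prod_(i | i != ord0) A t i (sg i))) => [t|].
  by rewrite [RHS](bigD1 ord0).
apply: order_geMr; first exact: As.
apply: order_ge_prod => i _; exact: order_ge_bounded (As _ _).
Qed.

Lemma mx_order_ge_ext m n s (A B : T -> 'M[K]_(m, n)) :
  A =1 B -> mx_order_ge s A -> mx_order_ge s B.
Proof. by move=> AB As i j; apply: order_ge_ext (As i j) => t; rewrite AB. Qed.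

Lemma mx_order_geW m n s u (A : T -> 'M[K]_(m, n)) : (u <= s)%N ->
  mx_order_ge s A -> mx_order_ge u A.
Proof. by move=> us As i j; apply: order_geW (As i j). Qed.

Lemma mx_order_ge_cst m n (M : 'M[K]_(m, n)) : mx_order_ge 0 (fun=> M).
Proof. by move=> i j; apply: order_ge_cst. Qed.

Lemma mx_order_geD m n s (A B : T -> 'M[K]_(m, n)) :
  mx_order_ge s A -> mx_order_ge s B -> mx_order_ge s (fun t => A t + B t).
Proof.
move=> As Bs i j; apply: order_ge_ext (order_geD (As i j) (Bs i j)) => t.
by rewrite mxE.
Qed.

Lemma mx_order_geB m n s (A B : T -> 'M[K]_(m, n)) :
  mx_order_ge s A -> mx_order_ge s B -> mx_order_ge s (fun t => A t - B t).
Proof.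
move=> As Bs i j.
apply: order_ge_ext (order_geD (As i j) (order_geN (Bs i j))) => t.
by rewrite !mxE.
Qed.

Lemma mx_order_geM m n p s u (A : T -> 'M[K]_(m, n)) (B : T -> 'M[K]_(n, p)) :
  mx_order_ge s A -> mx_order_ge u B ->
  mx_order_ge (s + u) (fun t => A t *m B t).
Proof.
move=> As Bs i j.
apply: (@order_ge_ext _ (fun t => \sum_k A t i k * B t k j)) => [t|].
  by rewrite mxE.
by apply: order_ge_sum => k _; apply: order_geM.
Qed.

Lemma mx_order_geMl m n p s (A : T -> 'M[K]_(m, n)) (B : T -> 'M[K]_(n, p)) :
  mx_order_ge 0 A -> mx_order_ge s B -> mx_order_ge s (fun t => A t *m B t).
Proof. exact: mx_order_geM. Qed.

Lemma mx_order_geMr m n p s (A : T -> 'M[K]_(m, n)) (B : T -> 'M[K]_(n, p)) :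
  mx_order_ge s A -> mx_order_ge 0 B -> mx_order_ge s (fun t => A t *m B t).
Proof. by move=> As B0; have := mx_order_geM As B0; rewrite addn0. Qed.

Lemma mx_order_geM_congr m n p s (A A' : T -> 'M[K]_(m, n))
    (B B' : T -> 'M[K]_(n, p)) :
  mx_order_ge 0 A' -> mx_order_ge 0 B ->
  mx_order_ge s (fun t => A t - A' t) -> mx_order_ge s (fun t => B t - B' t) ->
  mx_order_ge s (fun t => A t *m B t - A' t *m B' t).
Proof.
move=> A'0 B0 AA BB.
apply: mx_order_ge_ext (mx_order_geD
  (mx_order_geMr AA B0) (mx_order_geMl A'0 BB)) => t.
by rewrite mulmxBl mulmxBr addrA subrK.
Qed.

Lemma mx_order_geX n k (A : T -> 'M[K]_n) :
  mx_order_ge 0 A -> mx_order_ge 0 (fun t => A t ^+ k).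
Proof.
move=> A0; elim: k => [|k IH]; first exact: mx_order_ge_cst.
by apply: mx_order_ge_ext (mx_order_geMl A0 IH) => t; rewrite exprS.
Qed.

Lemma mx_order_geX_congr n k s (A B : T -> 'M[K]_n) :
  mx_order_ge 0 A -> mx_order_ge 0 B -> mx_order_ge s (fun t => A t - B t) ->
  mx_order_ge s (fun t => A t ^+ k - B t ^+ k).
Proof.
move=> A0 B0 AB; elim: k => [|k IH].
  move=> i j; apply: order_ge_ext (order_ge0 s) => t.
  by rewrite !expr0 subrr mxE.
apply: mx_order_ge_ext (mx_order_geM_congr B0 _ AB IH) => [t|].
  by rewrite !exprS.
exact: mx_order_geX.
Qed.

(** The pointwise approximations are chosen with [x = D * E t ^+ s], where
    [1 <= D] bounds the constants of all minors, so that [D <= D ^+ p.+1]. They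
    form bounded families because the bounds in [low_rank_approx] are
    explicit. *)
Lemma low_rank_approx_family p d s (P : T -> 'M[K]_d) : mx_order_ge 0 P ->
  (forall (f g : {ffun 'I_p.+1 -> 'I_d}),
     order_ge (p.+1 * s) (fun t => \det (mxsub f g (P t)))) ->
  exists (X : T -> 'M[K]_(d, p)) (Y : T -> 'M[K]_(p, d)),
  [/\ mx_order_ge 0 X, mx_order_ge 0 Y &
      mx_order_ge s (fun t => P t - X t *m Y t)].
Proof.
move=> P0 minors.
have [C C1 PC] := @order_ge_uniform ('I_d * 'I_d)%type 0
  (fun k t => P t k.1 k.2) (fun k => P0 k.1 k.2).
have [D D1 minD] := @order_ge_uniform
  ({ffun 'I_p.+1 -> 'I_d} * {ffun 'I_p.+1 -> 'I_d})%type (p.+1 * s)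
  (fun k t => \det (mxsub k.1 k.2 (P t))) (fun k => minors k.1 k.2).
have C0 : 0 <= C by apply: le_trans C1.
have D0 : 0 <= D by apply: le_trans D1.
have approx t : exists XY : 'M[K]_(d, p) * 'M[K]_(p, d),
  [/\ forall i j, w (XY.1 i j) <= 1,
      forall i j, w (XY.2 i j) <= 2 ^+ p * C &
      forall i j, w ((P t - XY.1 *m XY.2) i j) <= D * E t ^+ s].
  have [||i j|f g|X [Y HXY]] :=
    @low_rank_approx R K w p d d (P t) (D * E t ^+ s) C.
  - by rewrite mulr_ge0.
  - exact: C0.
  - by have := PC (i, j) t; rewrite mulr1.
  - have -> : mxsub f g (P t) = mxsub (finfun f) (finfun g) (P t).
      by apply/matrixP => i j; rewrite !mxE !ffunE.
    apply: le_trans (minD (finfun f, finfun g) t) _.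
    rewrite exprMn -exprM mulnC ler_wpM2r //.
    by rewrite exprS ler_peMr // exprn_ege1.
  - by exists (X, Y).
have [XY HXY] := choice approx.
exists (fun t => (XY t).1), (fun t => (XY t).2); split=> i j.
- by exists 1 => // t; have [h _ _] := HXY t; rewrite mulr1.
- exists (2 ^+ p * C); rewrite ?mulr_ge0 ?exprn_ge0 // => t.
  by have [_ h _] := HXY t; rewrite mulr1.
- by exists D => // t; have [_ _ h] := HXY t.
Qed.

End Orders.

Section CH.
Context (R : realType) (K : closedFieldType) (w : absolute_value R K).
Context (T : Type) (E : T -> R) (E01 : forall t, 0 <= E t <= 1).

Lemma char_poly_factor d (A : 'M[K]_d.+1) : exists s : seq K,
  [/\ size s = d.+1, forall l, l \in s -> eigenvalue A l &
      \prod_(0 <= i < d.+1) (A - (nth 0 s i)%:M) = 0].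
Proof.
have [s ps] := closed_field_poly_normal (char_poly A).
rewrite (monicP (char_poly_monic _)) scale1r in ps.
have sz : size s = d.+1.
  by have := congr1 (@size _ \o @polyseq _) ps;
     rewrite /= size_char_poly size_prod_XsubC => -[].
exists s; split=> // [l ls|].
  by rewrite eigenvalue_root_char ps root_prod_XsubC.
rewrite -[RHS](Cayley_Hamilton A) ps rmorph_prod /= [RHS](big_nth 0) sz.
by apply: eq_bigr => i _; rewrite rmorphB /= horner_mx_X horner_mx_C.
Qed.

(** A quantitative version of the fact that a matrix with all eigenvalues zero
    is nilpotent: modulo functions of order [s], the factors [A - l_i] in the
    Cayley-Hamilton identity are all equal to [A]. *)
Lemma mx_order_ge_eigen d s (c : R) (A : T -> 'M[K]_d.+1) : 0 <= c ->
  mx_order_ge w E 0 A ->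
  (forall t l, eigenvalue (A t) l -> w l <= c * E t ^+ s) ->
  mx_order_ge w E s (fun t => A t ^+ d.+1).
Proof.
move=> c0 A0 eig; have [S HS] := choice (fun t => char_poly_factor (A t)).
pose F i t := A t - (nth 0 (S t) i)%:M.
have nthS i : (i < d.+1)%N -> order_ge w E s (fun t => nth 0 (S t) i).
  move=> id; exists c => // t; have [sz eS _] := HS t.
  by apply: eig; apply: eS; rewrite mem_nth // sz.
have FA i : (i < d.+1)%N -> mx_order_ge w E s (fun t => A t - F i t).
  move=> id k l.
  apply: (@order_ge_ext _ _ _ _ _ _ (fun t => nth 0 (S t) i * (k == l)%:R)).
    by move=> t; rewrite /F opprB addrC subrK mxE mulr_natr.
  by apply: order_geMr => //; [exact: nthS|exact: order_ge_cst].
suff key n : (n <= d.+1)%N ->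
    mx_order_ge w E s (fun t => A t ^+ n - \prod_(0 <= i < n) F i t).
  apply: mx_order_ge_ext (key _ (leqnn _)) => t.
  by have [_ _ ->] := HS t; rewrite subr0.
elim: n => [|n IH] nd.
  move=> i j; apply: order_ge_ext (order_ge0 _ _ s) => t.
  by rewrite big_nil expr0 subrr mxE.
have F0 : mx_order_ge w E 0 (fun t => F n t).
  apply: mx_order_geB => // k l.
  apply: (@order_ge_ext _ _ _ _ _ _
    (fun t => (nth 0 (S t) n) * (k == l)%:R)).
    by move=> t; rewrite mxE mulr_natr.
  apply: order_geMr => //; last exact: order_ge_cst.
  exact: order_ge_bounded (nthS _ nd).
have Pn0 : mx_order_ge w E 0 (fun t => \prod_(0 <= i < n) F i t).
  apply: mx_order_ge_ext (mx_order_geB (mx_order_geX n A0)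
    (mx_order_geW E01 (leq0n s) (IH (ltnW nd)))) => t.
  by rewrite subKr.
have h := mx_order_geM_congr Pn0 A0 (IH (ltnW nd)) (FA n nd).
apply: mx_order_ge_ext h => t.
by rewrite exprSr big_nat_recr.
Qed.

End CH.

(** * Products of consecutive matrices and the drop of rank *)

Section Chain.
Context (K : fieldType) (d : nat).
Implicit Types (A : nat -> 'M[K]_d).

(** The product [A_(a + n - 1) *m ... *m A_a]; indexing by the number [n] of
    factors makes the concatenation of blocks additive. *)
Fixpoint chain A (a n : nat) : 'M[K]_d :=
  if n is m.+1 then A (a + m)%N *m chain A a m else 1%:M.

Lemma chain_add A a m n : chain A a (m + n) = chain A (a + m) n *m chain A a m.
Proof.
elim: n => [|n IH]; first by rewrite addn0 mul1mx.
by rewrite addnS /= IH addnA mulmxA.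
Qed.

Lemma chain_block A a m b n :
  chain (fun i => chain A (a + i * m) m) b n = chain A (a + b * m) (n * m).
Proof.
elim: n => [|n IH]; first by rewrite mul0n.
by rewrite [LHS]/= IH mulSnr chain_add mulnDl addnA.
Qed.

Lemma eq_chain A A' a n : (forall i, (a <= i < a + n)%N -> A i = A' i) ->
  chain A a n = chain A' a n.
Proof.
elim: n => //= n IH AA; rewrite AA; last by lia.
by rewrite IH // => i hi; apply: AA; lia.
Qed.

Lemma chain_eq0 A a n i : (a <= i < a + n)%N -> A i = 0 -> chain A a n = 0.
Proof.
elim: n => [|n IH] hi Ai /=; first by lia.
case: (eqVneq i (a + n)%N) Ai => [->|ne] Ai; first by rewrite Ai mul0mx.
by rewrite IH ?mulmx0 //; lia.
Qed.

Lemma det_chain A a n : \det (chain A a n) = \prod_(a <= i < a + n) \det (A i).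
Proof.
elim: n => [|n IH]; first by rewrite det1 addn0 big_geq.
by rewrite /= det_mulmx IH addnS big_nat_recr ?leq_addr //= mulrC.
Qed.

End Chain.

Lemma perm_exceedance n (sg : {perm 'I_n}) : sg != 1%g ->
  exists i : 'I_n, (i < sg i)%N.
Proof.
move=> sg1; apply/existsP; apply: contraNT sg1.
rewrite negb_exists => /forallP h.
apply/eqP/permP => i; rewrite perm1.
have [m] := ubnP (i : nat); elim: m i => // m IH i; rewrite ltnS => im.
have := h i; rewrite -leqNgt leq_eqVlt => /orP[/eqP/val_inj //|lt].
by have /perm_inj := IH _ (leq_trans lt im).
Qed.

Lemma mulmx_exprC (K : fieldType) d p (X : 'M[K]_(d, p)) (Y : 'M[K]_(p, d)) e :
  Y *m (X *m Y) ^+ e *m X = (Y *m X) ^+ e.+1.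
Proof.
elim: e => [|e IH]; first by rewrite expr0 mulmx1 expr1.
by rewrite exprSr [in RHS]exprSr -IH -!mulmxE !mulmxA.
Qed.

Lemma det_exprn (K : fieldType) p (X : 'M[K]_p) e : \det (X ^+ e) = \det X ^+ e.
Proof.
by elim: e => [|e IH]; rewrite ?det1 // !exprS -mulmxE det_mulmx IH.
Qed.

Section Step.
Context (R : realType) (K : fieldType) (w : absolute_value R K).
Context (T : Type) (E : T -> R) (E01 : forall t, 0 <= E t <= 1).
Local Notation oge := (order_ge w E).
Local Notation moge := (mx_order_ge w E).

Lemma mx_order_ge_chain d (A : nat -> T -> 'M[K]_d) a n :
  (forall i, moge 0 (A i)) -> moge 0 (fun t => chain (A^~ t) a n).
Proof.
move=> A0; elim: n => [|n IH] /=; first exact: mx_order_ge_cst.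
exact: mx_order_geMl.
Qed.

(** In the expansion of [\det (G t)], each permutation other than the identity
    uses some entry above the diagonal. If these entries become small after
    multiplication by [c], the diagonal term must therefore be small too,
    because the determinant vanishes. *)
Lemma order_ge_trig n s (c : T -> K) (G : T -> 'M[K]_n) :
  (forall t, \det (G t) = 0) -> moge 0 G ->
  (forall i j : 'I_n, (i < j)%N -> oge s (fun t => c t * G t i j)) ->
  oge s (fun t => c t * \prod_i G t i i).
Proof.
move=> G0 Gb Gs.
apply: (@order_ge_ext _ _ _ _ _ _ (fun t =>
   - \sum_(sg : {perm 'I_n} | sg != 1%g)
       (-1) ^+ sg * (c t * \prod_i G t i (sg i)))) => [t|].
  apply/eqP; rewrite eq_sym -addr_eq0.
  have := G0 t; rewrite /determinant (bigD1 (1%g : {perm 'I_n})) //=.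
  rewrite odd_perm1 expr0 mul1r.
  under [X in X + _ = 0]eq_bigr do rewrite perm1.
  under [X in _ -> is_true (_ + X == 0)]eq_bigr do rewrite mulrCA.
  move=> h.
  by rewrite -mulr_sumr -mulrDr h mulr0.
apply: order_geN; apply: order_ge_sum => sg sg1.
apply: (order_geMl (order_ge_cst _ _ _)).
have [i isg] := perm_exceedance sg1.
apply: (@order_ge_ext _ _ _ _ _ _ (fun t => (c t * G t i (sg i)) *
   \prod_(j | j != i) G t j (sg j))) => [t|].
  by rewrite [in RHS](bigD1 i) //= mulrA.
apply: order_geMr; first exact: Gs.
by apply: order_ge_prod => j _; apply: Gb.
Qed.

Section Factored.
Context (d p e s : nat) (B : nat -> T -> 'M[K]_d).
Context (X : nat -> T -> 'M[K]_(d, p.+1)) (Y : nat -> T -> 'M[K]_(p.+1, d)).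
Context (X0 : forall i, moge 0 (X i)) (Y0 : forall i, moge 0 (Y i)).
Let S := (e.+1 * (2 * (p.+1 * s)))%N.
Context (BXY : forall i, moge S (fun t => B i t - X i t *m Y i t)).
Context (Bnil : forall a n, moge S (fun t => chain (B^~ t) a n.+1 ^+ e)).

Let XY0 i : moge 0 (fun t => X i t *m Y i t).
Proof. exact: mx_order_geMl. Qed.

Let B0 i : moge 0 (B i).
Proof.
apply: mx_order_ge_ext (mx_order_geD
  (mx_order_geW E01 (leq0n _) (@BXY i)) (@XY0 i)) => t.
by rewrite subrK.
Qed.

(* The product of [B_a, ..., B_(a + n)] agrees, up to order [S], with [P a n],
   where [Q a n] collects the inner factors [Y_(l + 1) *m X_l]. *)
Let Q a n t := chain (fun l => Y l.+1 t *m X l t) a n.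
Let P a n t := X (a + n)%N t *m Q a n t *m Y a t.

Let Q0 a n : moge 0 (Q a n).
Proof.
by apply: (@mx_order_ge_chain _ (fun l t => Y l.+1 t *m X l t)) => i;
   apply: mx_order_geMl.
Qed.

Let P0 a n : moge 0 (P a n).
Proof. by apply: mx_order_geMl => //; apply: mx_order_geMl. Qed.

Lemma chain_factored a n : moge S (fun t => chain (B^~ t) a n.+1 - P a n t).
Proof.
elim: n => [|n IH].
  by apply: mx_order_ge_ext (@BXY a) => t; rewrite /P /= addn0 !mulmx1.
apply: mx_order_ge_ext (mx_order_geM_congr (@XY0 (a + n.+1)%N) _
  (@BXY (a + n.+1)%N) IH).
  by move=> t; rewrite /P /= addnS !mulmxA.
exact: mx_order_ge_chain.
Qed.

Let G i j t := \det (Y i t *m X j t).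

Let G0 i j : oge 0 (G i j).
Proof. by apply: order_ge_det0; apply: mx_order_geMl. Qed.

(** The cyclic product [Z = Q a n *m Y a *m X (a + n)] has small determinant:
    [P a n ^+ e] is small since the product of the [B_i] is almost nilpotent,
    and [Z ^+ e.+1] is obtained from it by multiplication on both sides. *)
Lemma order_ge_cycle a n : oge (2 * (p.+1 * s))
  (fun t => (\prod_(a <= l < a + n) G l.+1 l t) * G a (a + n)%N t).
Proof.
apply: (@order_ge_root _ _ _ _ _ E01 e).
have PS : moge S (fun t => P a n t ^+ e).
  apply: mx_order_ge_ext (mx_order_geB (@Bnil a n)
    (mx_order_geX_congr e _ _ (chain_factored a n))) => // [t|].
  - by rewrite subKr.
  - exact: mx_order_ge_chain.
have ZS : moge S (fun t => (Q a n t *m Y a t) *m P a n t ^+ e *m X (a + n)%N t).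
  apply: mx_order_geMr => //; apply: mx_order_geMl => //.
  exact: mx_order_geMl.
apply: order_ge_ext (order_ge_detS E01 ZS) => t.
rewrite /P -(mulmxA (X _ t)) mulmx_exprC det_exprn -mulmxA det_mulmx det_chain.
by [].
Qed.

Lemma order_ge_pairing M i j : (i <= j <= M)%N -> oge (2 * (p.+1 * s))
  (fun t => (\prod_(0 <= l < M) G l.+1 l t) * G i j t).
Proof.
case/andP=> ij jM.
apply: (@order_ge_ext _ _ _ _ _ _ (fun t =>
  (\prod_(0 <= l < i) G l.+1 l t * \prod_(j <= l < M) G l.+1 l t) *
  ((\prod_(i <= l < j) G l.+1 l t) * G i j t))) => [t|].
  rewrite [in RHS](big_cat_nat (n := i)) ?leq0n ?(leq_trans ij) //=.
  by rewrite [in RHS](big_cat_nat (m := i) (n := j)) //=; ring.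
apply: order_geMl.
  by apply: order_geMl; apply: order_ge_prod => l _; apply: G0.
by have := order_ge_cycle i (j - i); rewrite subnKC.
Qed.

(** The numbers [G i j = \det (Y i *m X j)] with [i <= j] are small after
    multiplication by the product [Tt] of the subdiagonal ones. Bordering this
    matrix by one column and one row of coordinate functions gives a matrix of
    size ['C(d, p.+1) + 1], hence singular, that is almost lower triangular with
    diagonal
    [\det (Y 0 *m SL), G 1 0, G 2 1, ..., G M (M - 1), \det (SK *m X M)].
    The product of these entries is exactly a minor of [P 0 M]; as this minor
    is also a bounded multiple of [Tt], its square is small. *)
Lemma order_ge_minor (f g : 'I_p.+1 -> 'I_d) M : 'C(d, p.+1) = M.+1 ->
  oge (p.+1 * s) (fun t => \det (mxsub f g (P 0 M t))).
Proof.
move=> CM.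
pose SK : 'M[K]_(p.+1, d) := rowsub f 1%:M.
pose SL : 'M[K]_(d, p.+1) := colsub g 1%:M.
pose Tt t := \prod_(0 <= l < M) G l.+1 l t.
pose dX t := \det (SK *m X M t); pose dY t := \det (Y 0 t *m SL).
have minorE t : \det (mxsub f g (P 0 M t)) = dX t * Tt t * dY t.
  have -> : mxsub f g (P 0 M t) = (SK *m X M t) *m Q 0 M t *m (Y 0 t *m SL).
    rewrite /P add0n !mulmxA mulmx_colsub mulmx1.
    by rewrite -(mulmxA SK) -(mulmxA SK) mul_rowsub_mx mul1mx -mxsub_comp.
  by rewrite !det_mulmx det_chain add0n.
pose YY (i : nat) t := if (i < M.+1)%N then Y i t else SK.
pose XX (j : nat) t := if j is j'.+1 then X j' t else SL.
have YY0 i : moge 0 (YY i).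
  by rewrite /YY; case: (i < M.+1)%N; first exact: Y0; exact: mx_order_ge_cst.
have XX0 j : moge 0 (XX j) by case: j => //=; exact: mx_order_ge_cst.
pose GG t := \matrix_(i < M.+2, j < M.+2) \det (YY i t *m XX j t).
have GG0 t : \det (GG t) = 0.
  by apply: (@det_pairing_eq0 K _ _ _ (fun i : 'I_M.+2 => YY i t)
    (fun j : 'I_M.+2 => XX j t)); rewrite CM.
have GGb : moge 0 GG.
  move=> i j.
  apply: (@order_ge_ext _ _ _ _ _ _ (fun t => \det (YY i t *m XX j t))).
    by move=> t; rewrite mxE.
  by apply: order_ge_det0; apply: mx_order_geMl.
have GGs (i j : 'I_M.+2) : (i < j)%N ->
    oge (2 * (p.+1 * s)) (fun t => Tt t * GG t i j).
  case: j => -[//|j] hj /= ij.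
  apply: order_ge_ext (@order_ge_pairing M i j _) => [t|]; last by lia.
  by rewrite mxE /YY /=; have -> : (i < M.+1)%N by lia.
have diag := order_ge_trig GG0 GGb GGs.
apply: (@order_ge_root _ _ _ _ _ E01 1).
have dXY : oge 0 (fun t => dX t * dY t).
  apply: order_geMl; apply: order_ge_det0; apply: mx_order_geMl => //;
    exact: mx_order_ge_cst.
apply: order_ge_ext (order_geMr diag dXY) => t; rewrite minorE.
suff -> : \prod_i GG t i i = dX t * Tt t * dY t.
  by rewrite expr2; ring.
rewrite big_ord_recr big_ord_recl /= !mxE /YY /= ltnn.
rewrite /Tt big_mkord mulrC [dY t * _]mulrC mulrA.
congr (_ * _ * _); apply: eq_bigr => i _.
by rewrite mxE /YY ifT; [|exact: (ltn_ord i)].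
Qed.

(** The minors of size [p + 1] of the product of ['C(d, p.+1)] blocks are small
    by [order_ge_minor], so elimination lowers the inner dimension to [p]. The
    order is divided by [e + 1] in [order_ge_cycle], by [2] in
    [order_ge_minor], and by [p + 1] in [low_rank_approx_family]. *)
Lemma rank_drop : (p < d)%N ->
  exists (X' : T -> 'M[K]_(d, p)) (Y' : T -> 'M[K]_(p, d)),
  [/\ moge 0 X', moge 0 Y' &
      moge s (fun t => chain (B^~ t) 0 'C(d, p.+1) - X' t *m Y' t)].
Proof.
move=> pd; have [M CM] : exists M, 'C(d, p.+1) = M.+1.
  by exists 'C(d, p.+1).-1; rewrite prednK // bin_gt0.
have [X' [Y' [X'0 Y'0 PXY]]] := low_rank_approx_family E01 (@P0 0 M)
  (fun f g => order_ge_minor f g CM).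
exists X', Y'; split=> //; rewrite CM.
apply: mx_order_ge_ext (mx_order_geD
  (mx_order_geW E01 _ (chain_factored 0 M)) PXY) => [t|].
  by rewrite addrA subrK.
by rewrite /S; nia.
Qed.

End Factored.
End Step.

(** * Descent on the rank *)

(** The order up to which blocks are close to rank [p]: passing from rank
    [q + 1] to rank [q] costs the factor [(d + 1) * 2 * (q + 1)] of [rank_drop],
    where [d] is the nilpotency exponent. *)
Definition level_exponent (d p : nat) : nat :=
  (\prod_(0 <= q < p) (d.+1 * (2 * q.+1)))%N.

(** The number of consecutive factors after which the rank is close to [p]. *)
Definition level_length (d p : nat) : nat :=
  (\prod_(p.+1 <= q < d.+1) 'C(d, q))%N.

Lemma level_exponentS d p :
  level_exponent d p.+1 = (d.+1 * (2 * (p.+1 * level_exponent d p)))%N.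
Proof. by rewrite /level_exponent big_nat_recr //=; nia. Qed.

Lemma level_exponent_mono d p q : (p <= q)%N ->
  (level_exponent d p <= level_exponent d q)%N.
Proof.
move=> /subnKC <-; elim: (q - p)%N => [|n IH]; first by rewrite addn0.
by rewrite addnS level_exponentS; nia.
Qed.

Lemma level_length_gt0 d p : (0 < level_length d p)%N.
Proof.
rewrite /level_length big_seq_cond; apply: prodn_cond_gt0 => q.
by rewrite mem_index_iota andbT bin_gt0 => /andP[_]; rewrite ltnS.
Qed.

Lemma level_lengthS d p : (p < d)%N ->
  level_length d p = ('C(d, p.+1) * level_length d p.+1)%N.
Proof. by move=> pd; rewrite /level_length big_ltn. Qed.

Section Levels.
Context (R : realType) (K : closedFieldType) (w : absolute_value R K).
Context (T : Type) (E : T -> R) (E01 : forall t, 0 <= E t <= 1).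
Context (d : nat) (c : R) (A : nat -> T -> 'M[K]_d.+1).
Local Notation moge := (mx_order_ge w E).
Context (c0 : 0 <= c) (A0 : forall i, moge 0 (A i)).
Context (Aeig : forall t a n l, eigenvalue (chain (A^~ t) a n.+1) l ->
  w l <= c * E t ^+ level_exponent d.+1 d.+1).

(** The descent on the rank [d.+1 - k]: at [k = 0] a block is a single factor,
    and each step is an application of [rank_drop] to consecutive blocks, whose
    products are again products of consecutive factors. *)
Lemma chain_low_rank k : (k <= d.+1)%N -> forall a,
  exists (X : T -> 'M[K]_(d.+1, d.+1 - k)) (Y : T -> 'M[K]_(d.+1 - k, d.+1)),
  [/\ moge 0 X, moge 0 Y &
      moge (level_exponent d.+1 (d.+1 - k))
        (fun t => chain (A^~ t) a (level_length d.+1 (d.+1 - k)) - X t *m Y t)].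
Proof.
elim: k => [|k IH] kd a.
  rewrite subn0; exists (A a), (fun=> 1%:M); split=> //.
    exact: mx_order_ge_cst.
  move=> i j; apply: order_ge_ext (order_ge0 _ _ _) => t.
  by rewrite /level_length big_geq //= mulmx1 addn0 mulmx1 subrr mxE.
have [p pE] : exists p, (d.+1 - k)%N = p.+1 by exists (d - k)%N; lia.
have -> : (d.+1 - k.+1)%N = p by lia.
have pd : (p < d.+1)%N by lia.
move: (IH (ltnW kd)); rewrite pE => {}IH.
set m := level_length d.+1 p.+1.
have /choice[X /choice[Y XY]] := fun i => IH (a + i * m)%N.
rewrite level_lengthS // -/m.
have [|||b n||X' [Y' H]] := @rank_drop R K w T E E01 d.+1 p d.+1
  (level_exponent d.+1 p) (fun i t => chain (A^~ t) (a + i * m) m) X Y.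
- by move=> i; have [] := XY i.
- by move=> i; have [] := XY i.
- by move=> i; have [_ _] := XY i; rewrite level_exponentS.
- apply: (mx_order_geW E01 (s := level_exponent d.+1 d.+1)).
    by have := @level_exponent_mono d.+1 p.+1 d.+1 pd; rewrite level_exponentS.
  apply: (mx_order_ge_eigen E01 c0) => [|t l].
    apply: mx_order_ge_ext (mx_order_ge_chain _ _ A0) => t.
    exact/esym/chain_block.
  rewrite chain_block; have -> : (n.+1 * m)%N = (n.+1 * m).-1.+1.
    by rewrite prednK // muln_gt0 level_length_gt0.
  exact: Aeig.
- exact: pd.
exists X', Y'; have [X'0 Y'0 HXY] := H; split=> //.
apply: mx_order_ge_ext HXY => t.
by rewrite chain_block mul0n addn0.
Qed.

Lemma chain_small : moge 1 (fun t => chain (A^~ t) 0 (level_length d.+1 0)).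
Proof.
have [] := chain_low_rank (leqnn d.+1) 0.
rewrite subnn => X [Y [_ _]]; rewrite /level_exponent big_geq //.
apply: mx_order_ge_ext => t.
by rewrite (thinmx0 (X t)) mul0mx subr0.
Qed.

End Levels.

Section Uniform.
Context (R : realType) (K : closedFieldType) (w : absolute_value R K).

(** With [T] taken to be the type of all admissible pairs [(A, x)], the
    statement [chain_small] about one family of data becomes an inequality with
    a constant uniform in [A] and [x]. Only the matrices with index below the
    length matter for the product, so [A] may be replaced by zero beyond it,
    which preserves the hypothesis on eigenvalues. *)
Lemma chain_le_uniform (d : nat) (c : R) : 0 <= c -> exists2 C : R, 0 <= C &
  forall (A : nat -> 'M[K]_d.+1) (x : R), 0 <= x <= 1 ->
  (forall i a b, (i < level_length d.+1 0)%N -> w (A i a b) <= c) ->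
  (forall a n l, (a + n < level_length d.+1 0)%N ->
     eigenvalue (chain A a n.+1) l ->
     w l <= c * x ^+ level_exponent d.+1 d.+1) ->
  forall a b, w (chain A 0 (level_length d.+1 0) a b) <= C * x.
Proof.
move=> c0; set N := level_length _ _; set r := level_exponent _ _.
pose good (Ax : (nat -> 'M[K]_d.+1) * R) := [/\ 0 <= Ax.2 <= 1,
  forall i a b, w (Ax.1 i a b) <= c &
  forall a n l, eigenvalue (chain Ax.1 a n.+1) l -> w l <= c * Ax.2 ^+ r].
pose T := {Ax | good Ax}.
pose E (t : T) := (sval t).2; pose B i (t : T) := (sval t).1 i.
have E01 t : 0 <= E t <= 1 by case: (svalP t).
have B0 i : mx_order_ge w E 0 (B i).
  move=> a b; exists c => // t; rewrite mulr1.
  by case: (svalP t) => _ h _; apply: h.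
have Beig (t : T) a n l : eigenvalue (chain (B^~ t) a n.+1) l ->
    w l <= c * E t ^+ r.
  by case: (svalP t) => _ _; apply.
have [C C1 HC] := @order_ge_uniform _ _ w T E E01 ('I_d.+1 * 'I_d.+1)%type 1
  (fun k t => chain (B^~ t) 0 N k.1 k.2)
  (fun k => chain_small E01 c0 B0 Beig k.1 k.2).
exists C => [|A x x01 Ac Aeig a b]; first exact: le_trans C1.
pose A' i := if (i < N)%N then A i else 0.
have AA' : chain A 0 N = chain A' 0 N.
  by apply: eq_chain => i; rewrite /A' => /andP[_ ->].
have gA : good (A', x).
  split=> //= [i i1 i2|i n l].
    by rewrite /A'; case: ifP => h; [exact: Ac|rewrite mxE absv0].
  suff: eigenvalue (chain A' i n.+1) l -> w l <= c * x ^+ r by [].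
  have [lt|ge] := ltnP (i + n)%N N.
    rewrite (_ : chain A' i n.+1 = chain A i n.+1); first exact: Aeig.
    by apply: eq_chain => j hj; rewrite /A' ifT //; lia.
  rewrite (@chain_eq0 _ _ A' i n.+1 (i + n)%N); last 2 first.
  - lia.
  - by rewrite /A' ltnNge ge.
  case/eigenvalueP => v; rewrite mulmx0 => /esym/eqP; rewrite scalemx_eq0.
  case/orP => [/eqP -> _|/eqP ->]; last by rewrite eqxx.
  by rewrite absv0 mulr_ge0 // exprn_ge0 //; case/andP: x01.
by have := HC (a, b) (exist _ _ gA); rewrite /= -AA' expr1.
Qed.

End Uniform.

(** * Scalars and norms *)

Section Scaling.
Context (R : realType) (k : fieldType) (v : absolute_value R k).
Local Open Scope classical_set_scope.

Lemma absv_gt0 x : x != 0 -> 0 < v x.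
Proof.
move=> x0; rewrite lt_neqAle absv_ge0 andbT eq_sym.
by apply: contra_neq x0 => /absv_eq0.
Qed.

(** If no nonzero element had absolute value less than [1], the balls of radius
    [1] would be points. *)
Lemma local_field_contracting : is_local_field v ->
  exists2 z, z != 0 & v z < 1.
Proof.
move=> [nd _]; apply: contrapT => triv; apply: nd => U.
rewrite openE => x Ux; rewrite /interior; apply/nbhs_ballP.
exists 1 => //= y; rewrite /ball /= /absv_ball /= => xy.
suff -> : y = x by [].
apply/eqP; rewrite eq_sym; apply: contraPT isT => ne _.
by apply: triv; exists ((x : k) - y); rewrite ?subr_eq0.
Qed.

Lemma expr_small (q x : R) : 0 <= q < 1 -> 0 < x -> exists n, q ^+ n < x.
Proof.
case/andP=> q0 q1 x0.
have /cvgr0_norm_lt/(_ x x0)[n _ /(_ n (leqnn n))] : q ^+ n @[n --> \oo] --> 0.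
  by apply: cvg_expr; rewrite ger0_norm.
by rewrite /= ger0_norm ?exprn_ge0 // => h; exists n.
Qed.

(** The absolute value need not take the value [x], but the powers of [z] times
    a large element leave multiplicative gaps of [v z] only. *)
Lemma absv_approx z (x : R) : z != 0 -> v z < 1 -> 0 < x ->
  exists2 l, l != 0 & v l <= x <= v l / v z.
Proof.
move=> z0 z1 x0; have vz := absv_gt0 z0.
have q01 : 0 <= v z < 1 by rewrite ltW.
have [M HM] : exists M, v z ^+ M < x^-1 by apply: expr_small; rewrite ?invr_gt0.
have big : x < (v z ^+ M)^-1.
  by rewrite -[x]invrK ltf_pV2 ?posrE ?invr_gt0 ?exprn_gt0.
have ex : exists n, v (z ^+ M)^-1 * v z ^+ n < x.
  have [||n Hn] := @expr_small (v z) (x * v z ^+ M) => //.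
    by rewrite mulr_gt0 // exprn_gt0.
  by exists n; rewrite absvV absvX mulrC ltr_pdivrMr ?exprn_gt0.
case: (ex_minnP ex) => -[|n] Hn nmin.
  move: Hn; rewrite expr0 mulr1 absvV absvX => /lt_trans/(_ big).
  by rewrite ltxx.
exists ((z ^+ M)^-1 * z ^+ n.+1).
  by rewrite mulf_neq0 ?invr_neq0 ?expf_neq0.
rewrite absvM absvX ltW //= exprSr mulrA mulfK ?gt_eqF // leNgt.
by apply/negP => /nmin; rewrite ltnn.
Qed.

End Scaling.

Section Norms.
Context (R : realType) (k : fieldType) (v : absolute_value R k) (d : nat).
Context (nrm : 'M[k]_d.+1 -> R) (nrmP : is_norm v nrm).

Let nrm0 : nrm 0 = 0. Proof. exact/(is_norm_eq0 nrmP). Qed.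

(** Submultiplicativity gives this half of the equivalence of norms without
    completeness: multiplying [M] by elementary matrices on both sides isolates
    an entry. *)
Lemma entry_le_norm : submultiplicative nrm ->
  exists2 c, 0 <= c & forall (M : 'M[k]_d.+1) i j, v (M i j) <= c * nrm M.
Proof.
move=> sub; pose D i j : 'M[k]_d.+1 := delta_mx i j.
have D0 : 0 < nrm (D ord0 ord0).
  rewrite lt_neqAle (is_norm_ge0 nrmP) andbT eq_sym.
  apply/negP => /eqP /(is_norm_eq0 nrmP) /matrixP/(_ ord0 ord0)/eqP.
  by rewrite !mxE eqxx oner_eq0.
pose c i j := nrm (D ord0 i) * nrm (D j ord0) / nrm (D ord0 ord0).
have c0 i j : 0 <= c i j.
  by rewrite /c divr_ge0 ?mulr_ge0 // (is_norm_ge0 nrmP).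
have entry (M : 'M[k]_d.+1) i j : v (M i j) <= c i j * nrm M.
  have DMD : D ord0 i *m M *m D j ord0 = M i j *: D ord0 ord0.
    apply/matrixP => a b; rewrite !mxE (bigD1 j) //= big1 ?addr0 => [|l lj].
      rewrite !mxE (bigD1 i) //= big1 ?addr0 => [|l li].
        by rewrite !mxE !eqxx /= andbT mulrAC -natrM mulnb mulrC.
      by rewrite !mxE (negPf li) andbF mul0r.
    by rewrite !mxE (negPf lj) mulr0.
  have h : v (M i j) * nrm (D ord0 ord0) <=
      nrm (D ord0 i) * nrm M * nrm (D j ord0).
    rewrite -(is_normZ nrmP) -DMD; apply: le_trans (sub _ _) _.
    by rewrite ler_wpM2r ?(is_norm_ge0 nrmP).
  rewrite -(ler_pM2r D0); apply: le_trans h _.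
  by rewrite /c [X in _ <= X]mulrAC divfK ?gt_eqF // mulrAC.
exists (\sum_i \sum_j c i j) => [|M i j].
  by apply: sumr_ge0 => i _; apply: sumr_ge0.
apply: le_trans (entry M i j) _; rewrite ler_wpM2r ?(is_norm_ge0 nrmP) //.
rewrite (bigD1 i) //= (bigD1 j) //= -addrA lerDl addr_ge0 //.
  exact: sumr_ge0.
by apply: sumr_ge0 => l _; apply: sumr_ge0.
Qed.

Lemma norm_le_entry :
  exists2 c, 0 <= c & forall (M : 'M[k]_d.+1) x,
    (forall i j, v (M i j) <= x) -> nrm M <= c * x.
Proof.
have nsum (I : Type) (r : seq I) (F : I -> 'M[k]_d.+1) :
    nrm (\sum_(i <- r) F i) <= \sum_(i <- r) nrm (F i).
  elim/big_rec2 : _ => [|i y x _ xy]; first by rewrite nrm0.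
  exact: le_trans (is_normD nrmP _ _) (lerD (lexx _) xy).
exists (\sum_i \sum_j nrm (delta_mx i j)) => [|M x Mx].
  by apply: sumr_ge0 => i _; apply: sumr_ge0 => j _; apply: (is_norm_ge0 nrmP).
rewrite [M in nrm M]matrix_sum_delta mulr_suml; apply: le_trans (nsum _ _ _) _.
apply: ler_sum => i _; rewrite mulr_suml; apply: le_trans (nsum _ _ _) _.
apply: ler_sum => j _; rewrite (is_normZ nrmP) mulrC.
by rewrite ler_wpM2l // (is_norm_ge0 nrmP).
Qed.

Lemma norm_chain_le (A : nat -> 'M[k]_d.+1) a m n : submultiplicative nrm ->
  nrm (chain A a (m + n)) <=
  (\prod_(a + m <= i < a + m + n) nrm (A i)) * nrm (chain A a m).
Proof.
move=> sub; elim: n => [|n IH].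
  by rewrite !addn0 big_geq ?mul1r.
rewrite !addnS /= big_nat_recr ?leq_addr //=; apply: le_trans (sub _ _) _.
rewrite addnA [X in _ <= X]mulrAC [X in _ <= X]mulrC.
by rewrite ler_wpM2l // (is_norm_ge0 nrmP).
Qed.

End Norms.

Section ChainExtra.
Context (k : fieldType) (d : nat).
Implicit Types A : nat -> 'M[k]_d.

Lemma mxprod_revE A a b : mxprod_rev A a b = chain A a (b.+1 - a).
Proof.
rewrite /mxprod_rev /index_iota; elim: (b.+1 - a)%N => [|n IH].
  by rewrite big_nil.
by rewrite -[in LHS]addn1 iotaD cats1 rev_rcons big_cons IH.
Qed.

Lemma chain_scale A (c : nat -> k) a n : chain (fun i => c i *: A i) a n =
  (\prod_(a <= i < a + n) c i) *: chain A a n.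
Proof.
elim: n => [|n IH]; first by rewrite addn0 big_geq // scale1r.
rewrite /= IH addnS big_nat_recr ?leq_addr //= -scalemxAl -scalemxAr scalerA.
by rewrite mulrC.
Qed.

Lemma chain_succ A a n : chain (fun i => A i.+1) a n = chain A a.+1 n.
Proof. by elim: n => //= n ->; rewrite addSn. Qed.

Lemma chain_map (K : fieldType) (iota : {rmorphism k -> K}) A a n :
  chain (fun i => map_mx iota (A i)) a n = map_mx iota (chain A a n).
Proof. by elim: n => [|n IH] /=; rewrite ?map_mx1 // IH map_mxM. Qed.

End ChainExtra.

Lemma absv_prod (R : realType) (k : fieldType) (v : absolute_value R k)
  (I : Type) (r : seq I) (f : I -> k) :
  v (\prod_(i <- r) f i) = \prod_(i <- r) v (f i).
Proof. by apply: (big_morph v) => [x y|]; [exact: absvM|exact: absv1]. Qed.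

(** The exponent is at most [(d + 1) ^ (3 d)], because each factor
    [(d + 1) * 2 * q] with [q <= d] is at most [(d + 1) ^ 3], and
    [3 d <= d ^ 2 + 2] as [(d - 1) (d - 2) >= 0]. *)
Lemma level_exponent_le d : (0 < d)%N -> (level_exponent d d <=
  (level_length d 0 * d + 1) ^ (level_length d 0 * d ^ 2 + 2))%N.
Proof.
move=> d0; set N := level_length d 0.
have N0 : (0 < N)%N by apply: level_length_gt0.
have h p : (p <= d)%N -> (level_exponent d p <= d.+1 ^ (3 * p))%N.
  elim: p => [|p IH] pd; first by rewrite /level_exponent big_geq.
  have := IH (ltnW pd); rewrite level_exponentS mulnS expnD.
  move: (level_exponent _ _) (d.+1 ^ _)%N => a b ab.
  by rewrite !expnS expn0; nia.
apply: leq_trans (h d (leqnn d)) _.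
apply: (@leq_trans (d.+1 ^ (N * d ^ 2 + 2))).
  have d2 : (3 * d <= d ^ 2 + 2)%N.
    by case: d d0 {h N N0} => [|[|[|d]]] // _; rewrite -mulnn; nia.
  by rewrite leq_exp2l // (leq_trans d2) // leq_add2r leq_pmull.
by rewrite leq_exp2r ?addn2 // -addn1 leq_add2r leq_pmull.
Qed.

(** * The inequality *)

Lemma eigenvalueZ (K : fieldType) d (M : 'M[K]_d) c l : c != 0 ->
  eigenvalue (c *: M) l -> eigenvalue M (c^-1 * l).
Proof.
move=> c0 /eigenvalueP[x xM x0]; apply/eigenvalueP; exists x => //.
by rewrite -scalerA -xM -scalemxAr scalerA mulVf // scale1r.
Qed.

Lemma le_bigmax_triangle (R : realType) (F : nat -> nat -> R) n a b :
  (1 <= a)%N -> (a <= b <= n)%N ->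
  F a b <=
  \big[Num.max/0]_(1 <= i < n.+1) \big[Num.max/0]_(i <= j < n.+1) F i j.
Proof.
move=> a1 abn.
have a_in : a \in index_iota 1 n.+1 by rewrite mem_index_iota; lia.
have b_in : b \in index_iota a n.+1 by rewrite mem_index_iota; lia.
apply: (le_trans (le_bigmax_seq 0 b xpredT (F a) b_in isT)).
exact: (le_bigmax_seq 0 a xpredT
  (fun i => \big[Num.max/0]_(i <= j < n.+1) F i j)).
Qed.

Section Main.
Context (R : realType) (k : fieldType) (v : absolute_value R k).
Context (K : closedFieldType) (iota : {rmorphism k -> K}).
Context (w : absolute_value R K) (wv : forall x, w (iota x) = v x).
Context (d : nat).
Local Notation N := (level_length d.+1 0).
Local Notation r := (level_exponent d.+1 d.+1).

(** The estimate for exactly [N] nonzero factors. The factors are divided by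
    scalars [L i] of absolute value close to their norms, which turns
    [chain_le_uniform], stated for bounded matrices, into a homogeneous
    inequality. *)
Lemma chain_le_spectral (nrm : 'M[k]_d.+1 -> R) :
  is_local_field v -> is_norm v nrm -> submultiplicative nrm ->
  exists2 C : R, 0 <= C & forall (A : nat -> 'M[k]_d.+1) (x : R), 0 <= x <= 1 ->
  (forall i, (1 <= i <= N)%N -> A i != 0) ->
  (forall a n, (1 <= a)%N -> (a + n <= N)%N ->
     spectral_radius iota w (chain A a n.+1) <=
     x ^+ r * \prod_(a <= i < a + n.+1) nrm (A i)) ->
  nrm (chain A 1 N) <= C * x * \prod_(1 <= i < N.+1) nrm (A i).
Proof.
move=> lf nrmP sub.
have [z z0 z1] := local_field_contracting lf.
have vz := absv_gt0 v z0.
have /choice[lam Hlam] : forall y : R, exists l : k,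
    0 < y -> l != 0 /\ v l <= y <= v l / v z.
  move=> y; have [y0|_] := ltP 0 y; last by exists 0.
  by have [l l0 hl] := absv_approx z0 z1 y0; exists l.
have [c1 c10 entry] := entry_le_norm nrmP sub.
have [c2 c20 upper] := norm_le_entry nrmP.
(* The first term bounds the entries of the rescaled matrices, the second one
   the products of at most [N] ratios [nrm (A i) / v (L i) <= (v z)^-1]. *)
pose c := c1 / v z + (v z)^-1 ^+ N.
have c0 : 0 <= c by rewrite addr_ge0 ?divr_ge0 ?exprn_ge0 ?invr_ge0 // ltW.
have [C C0 HC] := chain_le_uniform w d c0.
exists (c2 * C) => [|A x x01 Anz rho]; first by rewrite mulr_ge0.
have x0 : 0 <= x by case/andP: x01.
have nrm_gt0 i : (1 <= i <= N)%N -> 0 < nrm (A i).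
  move=> /Anz Ai; rewrite lt_neqAle (is_norm_ge0 nrmP) andbT eq_sym.
  by apply: contra_neq Ai => /(is_norm_eq0 nrmP).
pose L i := lam (nrm (A i)).
have LP i : (1 <= i <= N)%N ->
  [/\ L i != 0, v (L i) <= nrm (A i) & nrm (A i) <= v (L i) / v z].
  by move=> hi; have [? /andP[]] := Hlam _ (nrm_gt0 i hi); split.
pose B i := map_mx iota ((L i.+1)^-1 *: A i.+1).
have chainB a n : chain B a n = iota (\prod_(a.+1 <= i < a.+1 + n) (L i)^-1) *:
    map_mx iota (chain A a.+1 n).
  rewrite /B (chain_map iota (fun i => (L i.+1)^-1 *: A i.+1)).
  by rewrite (chain_succ (fun i => (L i)^-1 *: A i)) chain_scale map_mxZ.
have Lprod0 a n : (1 <= a)%N -> (a + n <= N.+1)%N ->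
    0 < \prod_(a <= i < a + n) v (L i).
  move=> a1 an; rewrite big_seq prodr_gt0 // => i; rewrite mem_index_iota => hi.
  by have [] := LP i; [clear -an a1 hi; lia|move=> /(absv_gt0 v)].
have vLprod a n : w (iota (\prod_(a <= i < a + n) (L i)^-1)) =
    (\prod_(a <= i < a + n) v (L i))^-1.
  by rewrite wv absv_prod -prodfV; apply: eq_bigr => i _; rewrite absvV.
have Bentry i a b : (i < N)%N -> w (B i a b) <= c.
  move=> iN; have [L0 _ Lu] := LP i.+1 iN; have vL := absv_gt0 v L0.
  rewrite /B !mxE wv absvM absvV ler_pdivrMl //.
  apply: le_trans (entry (A i.+1) a b) _.
  apply: le_trans (ler_wpM2l c10 Lu) _.
  rewrite mulrCA ler_wpM2l ?absv_ge0 // lerDl exprn_ge0 // invr_ge0 ltW //.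
have Beig a n l : (a + n < N)%N -> eigenvalue (chain B a n.+1) l ->
    w l <= c * x ^+ r.
  move=> an; rewrite chainB; set q := \prod_(_ <= _ < _) _.
  have P0 : 0 < \prod_(a.+1 <= i < a.+1 + n.+1) v (L i).
    by apply: Lprod0 => //; clear -an; lia.
  have q0 : iota q != 0.
    apply/eqP => /(congr1 w); rewrite vLprod absv0 => /eqP.
    by rewrite invr_eq0 gt_eqF.
  move=> /(eigenvalueZ q0) eig.
  have [_ /(_ _ eig)] :=
    spectral_radius_max iota w (chain A a.+1 n.+1) (ltn0Sn d).
  move=> /le_trans/(_ (rho a.+1 n isT _)); rewrite absvM absvV vLprod invrK.
  rewrite mulrC -ler_pdivlMr //.
  move=> /(_ an)/le_trans; apply.
  rewrite -mulrA mulrC ler_wpM2r ?exprn_ge0 //.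
  apply: (@le_trans _ _ ((v z)^-1 ^+ n.+1)); last first.
    apply: (@le_trans _ _ ((v z)^-1 ^+ N)).
      by rewrite ler_weXn2l ?invf_ge1 ?ltW //; clear -an; lia.
    by rewrite lerDr divr_ge0 // ltW.
  rewrite -prodfV -big_split /=.
  have -> : (v z)^-1 ^+ n.+1 = \prod_(a.+1 <= i < a.+1 + n.+1) (v z)^-1.
    by rewrite prodr_const_nat addKn.
  rewrite !big_seq; apply: ler_prod => i; rewrite mem_index_iota => hi.
  have [|L0 _ Lu] := LP i; first by clear -an hi; lia.
  have vL := absv_gt0 v L0.
  rewrite divr_ge0 ?(is_norm_ge0 nrmP) ?absv_ge0 //=.
  by rewrite ler_pdivrMr // [X in _ <= X]mulrC.
have main := HC B x x01 Bentry Beig.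
rewrite -!mulrA; apply: upper => i j.
have := main i j; rewrite chainB !mxE absvM vLprod wv ler_pdivrMl; last first.
  by apply: Lprod0.
move=> /le_trans; apply; rewrite mulrC -mulrA ler_wpM2l // ler_wpM2l //.
rewrite add1n !big_seq; apply: ler_prod => l; rewrite mem_index_iota => hl.
by have [//|_ Ll _] := LP l; rewrite absv_ge0.
Qed.

End Main.

(* The family A_1, ..., A_n is given by the values of [A] at 1, ..., n.
   When some A_i is zero, the product of the norms vanishes, and with it the
   right-hand side. *)
Theorem theorem1p2 (R : realType) (d : nat) (hd : (1 <= d)%N) :
  exists N : nat, (0 < N <= \prod_(1 <= i < d.+1) 'C(d, i))%N /\
  exists r : R, 0 < r <= ((N * d + 1) ^ (N * d ^ 2 + 2))%N%:R /\
  forall (k : fieldType) (v : absolute_value R k), is_local_field v ->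
  forall (kbar : closedFieldType) (iota : {rmorphism k -> kbar})
         (w : absolute_value R kbar),
    is_algebraic_closure iota -> (forall x : k, w (iota x) = v x) ->
  forall nrm : 'M[k]_d -> R, is_norm v nrm -> submultiplicative nrm ->
  exists C : R, 1 < C /\
  forall n : nat, (N <= n)%N -> forall A : nat -> 'M[k]_d,
    nrm (mxprod_rev A 1 n) <=
      C * (\prod_(1 <= i < n.+1) nrm (A i)) *
      \big[Num.max/0]_(1 <= a < n.+1) \big[Num.max/0]_(a <= b < n.+1)
        (spectral_radius iota w (mxprod_rev A a b) /
          \prod_(a <= i < b.+1) nrm (A i)) `^ r^-1.
Proof.
case: d hd => // d _.
exists (level_length d.+1 0); split; first by rewrite level_length_gt0 leqnn.
set N := level_length d.+1 0; set e := level_exponent d.+1 d.+1.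
have N0 : (0 < N)%N by apply: level_length_gt0.
have e0 : (0 < e)%N.
  have := @level_exponent_mono d.+1 0 d.+1 isT.
  by rewrite {1}/level_exponent big_geq.
exists e%:R; split; first by rewrite ltr0n e0 ler_nat level_exponent_le.
move=> k v lf kbar iota w _ wv nrm nrmP sub.
have [C C0 HC] := chain_le_spectral wv lf nrmP sub.
(* The constant must exceed [1] and be at least [C]. *)
exists (C + 2); split; first by lra.
move=> n Nn A; rewrite mxprod_revE subn1 /=.
set M := \big[Num.max/0]_(1 <= a < n.+1) _.
have M0 : 0 <= M by apply: bigmax_ge_id.
have nrm0 M' : 0 <= nrm M' by apply: (is_norm_ge0 nrmP).
have nrm_chain m : (1 <= m <= n)%N -> nrm (chain A 1 n) <=
    (\prod_(m.+1 <= i < n.+1) nrm (A i)) * nrm (chain A 1 m).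
  move=> /andP[m1 mn]; have := norm_chain_le nrmP A 1 m (n - m) sub.
  by rewrite subnKC // !add1n addSn subnKC.
have nrm_le : nrm (chain A 1 n) <= \prod_(1 <= i < n.+1) nrm (A i).
  have n1 : (1 <= 1 <= n)%N by rewrite (leq_trans N0 Nn).
  apply: le_trans (nrm_chain _ n1) _.
  by rewrite [X in _ <= X]big_ltn // mulrC /= mulmx1 addn0.
have prod0 : 0 <= \prod_(1 <= i < n.+1) nrm (A i) by apply: prodr_ge0.
(* If the maximum is at least 1, submultiplicativity suffices. *)
have [M1|M1] := leP 1 M.
  apply: le_trans nrm_le _; rewrite mulrAC ler_peMl //.
  by rewrite -[1]mulr1 ler_pM //; lra.
have [Anz|/existsNP[i /not_implyP[hi /negP]]] :=
    pselect (forall i, (1 <= i <= n)%N -> A i != 0); last first.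
  rewrite negbK => /eqP Ai.
  rewrite (@chain_eq0 _ _ A 1 n i) // (is_norm_eq0 nrmP 0).2 // !mulr_ge0 //.
  by lra.
have nrm_gt0 i : (1 <= i <= n)%N -> 0 < nrm (A i).
  move=> /Anz Ai; rewrite lt_neqAle nrm0 andbT eq_sym.
  by apply: contra_neq Ai => /(is_norm_eq0 nrmP).
have key : nrm (chain A 1 N) <= C * M * \prod_(1 <= i < N.+1) nrm (A i).
  apply: HC => [|i hi|a m a1 am]; first by rewrite M0 ltW.
    by apply: Anz; clear -hi Nn; lia.
  set rho := spectral_radius _ _ _; set P := \prod_(_ <= _ < _) _.
  have P0 : 0 < P.
    rewrite /P big_seq prodr_gt0 // => i; rewrite mem_index_iota => hi.
    by apply: nrm_gt0; clear -hi a1 am Nn; lia.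
  have rho0 : 0 <= rho.
    have [[l _ wl] _] := spectral_radius_max iota w (chain A a m.+1) (ltn0Sn d).
    by rewrite /rho -wl absv_ge0.
  have y0 : 0 <= rho / P by rewrite divr_ge0 // ltW.
  rewrite -ler_pdivrMr //.
  have le_M : (rho / P) `^ (e%:R)^-1 <= M.
    pose F i j := (spectral_radius iota w (mxprod_rev A i j) /
      \prod_(i <= l < j.+1) nrm (A l)) `^ (e%:R)^-1.
    have amn : (a <= a + m <= n)%N by clear -am a1 Nn; lia.
    apply: le_trans (le_bigmax_triangle F a1 amn).
    by rewrite /F mxprod_revE -addnS addKn.
  have <- : ((rho / P) `^ (e%:R)^-1) `^ e%:R = rho / P.
    by rewrite -powRrM mulVf ?powRr1 // pnatr_eq0 -lt0n.
  by rewrite powR_mulrn ?powR_ge0 // lerXn2r ?nnegrE ?powR_ge0.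
have N1 : (1 <= N <= n)%N by rewrite N0.
apply: le_trans (nrm_chain N N1) _.
have tail0 : 0 <= \prod_(N.+1 <= i < n.+1) nrm (A i) by apply: prodr_ge0.
apply: le_trans (ler_wpM2l tail0 key) _.
have -> : \prod_(1 <= i < n.+1) nrm (A i) =
    (\prod_(1 <= i < N.+1) nrm (A i)) * \prod_(N.+1 <= i < n.+1) nrm (A i).
  by rewrite (big_cat_nat (n := N.+1)).
have head0 : 0 <= \prod_(1 <= i < N.+1) nrm (A i) by apply: prodr_ge0.
have := mulr_ge0 (mulr_ge0 head0 tail0) M0.
set H := \prod_(1 <= i < N.+1) _; set U := \prod_(_ <= i < _) _.
clear; lra.
Qed.
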